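(* Let $S$ be a max-$\cdot$ convex compactum. Then there exist a cardinal number $\tau$ and a $(\cdot,+)$-affine embedding $h:S\to\mathbb{R}^\tau$, i.e. a continuous map $h:S\to\mathbb R^\tau$ which is a homeomorphism onto its image and satisfies $h(\lambda\cdot s\vee k)=(\ln(\lambda)+h(s))\vee h(k)$ for all $\lambda\in[0,1]$ and all $s,k\in S$.
   Context: For a set $T$, points $x,y\in[0,1]^T$ and $\lambda\in[0,1]$: $x\vee y$ is the coordinatewise maximum and $\lambda\cdot x$ is the point with coordinates $\lambda x_t$, $t\in T$; the operation $\cdot$ has higher priority than $\vee$. A subset $A\subset[0,1]^T$ is max-$\cdot$ convex if $\lambda\cdot a\vee b\in A$ for all $a,b\in A$ and $\lambda\in[0,1]$. A max-$\cdot$ convex compactum is a max-$\cdot$ convex compact subset of $[0,1]^T$ (product topology) for some set $T$. In $\mathbb{R}^\tau$ (product topology), $\vee$ is the coordinatewise maximum and, for $\lambda\in[-\infty,0]$, $\lambda+x$ is obtained by adding $\lambda$ to each coordinate of $x$. Conventions: $\ln(0)=-\infty$, $-\infty+x=-\infty$ and $-\infty\vee x=x$. *)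

(* Defs.v *)
From HB Require Import structures.
From mathcomp Require Import all_boot all_order all_algebra.
From mathcomp Require Import all_classical all_reals all_analysis.

Set Implicit Arguments.
Unset Strict Implicit.
Unset Printing Implicit Defensive.

Import Order.TTheory GRing.Theory Num.Theory.
Import numFieldNormedType.Exports.

Local Open Scope classical_set_scope.
Local Open Scope ring_scope.

Definition maxdot (R : realType) (T : Type) (lambda : R) (a b : {ptws T -> R}) :
    {ptws T -> R} :=
  fun t => Num.max (lambda * a t) (b t).

Definition cube (R : realType) (T : Type) : set {ptws T -> R} :=
  [set x | forall t, 0 <= x t <= 1].

Definition maxdot_convex (R : realType) (T : Type) (A : set {ptws T -> R}) :=
  forall (a b : {ptws T -> R}) (lambda : R),
    A a -> A b -> 0 <= lambda <= 1 -> A (maxdot lambda a b).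

(* Compactness in R^T is the same as compactness in the subspace [0,1]^T. *)
Definition maxdot_convex_compactum (R : realType) (T : Type)
    (S : set {ptws T -> R}) :=
  [/\ S `<=` @cube R T, maxdot_convex S & compact S].

(* Taking values in \bar R gives a meaning to lambda = -oo: there
   -oo + x = -oo and max(-oo, x) = x for every real x. *)
Definition maxplus (R : realType) (I : Type) (lambda : \bar R)
    (x y : I -> \bar R) : I -> \bar R :=
  fun i => Order.max (lambda + x i)%E (y i).

(* Here lne is the extended logarithm, with lne 0 = -oo; the equality is one
   of functions to \bar R because lne lambda may be -oo. *)
Definition dot_plus_affine (R : realType) (T I : Type) (S : set {ptws T -> R})
    (h : {ptws T -> R} -> {ptws I -> R}) :=
  forall (lambda : R) (s k : {ptws T -> R}),
    0 <= lambda <= 1 -> S s -> S k ->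
    EFin \o h (maxdot lambda s k) =
      maxplus (lne lambda%:E) (EFin \o h s) (EFin \o h k).

(* A map S -> Y is represented by a function on all of X, of which only the
   restriction to S matters; likewise for the inverse h(S) -> S. *)
Definition embedding_on (X Y : topologicalType) (S : set X) (h : X -> Y) :=
  {within S, continuous h} /\
  exists g : Y -> X,
    {within h @` S, continuous g} /\ (forall s, S s -> g (h s) = s).

(* Main.v *)
(* A coordinate s |-> s_t is max-linear, but its logarithm is -oo where s_t = 0.
   Clipping it from below at any c > 0 repairs this and keeps max-linearity on
   [0, 1], because lambda <= 1 gives
     max (lambda s_t, k_t, c) = max (lambda max (s_t, c), max (k_t, c)).
   The maps ln (max (s_t, e^r)), for t in T and r real, are therefore real
   valued, affine and continuous; letting r tend to -oo, they determine s_t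
   uniformly in s, so that the inverse is continuous too. *)
Require Import Defs.
From mathcomp Require Import all_boot all_order all_algebra.
From mathcomp Require Import all_classical all_reals all_analysis.
From mathcomp Require Import lra.
Import Order.TTheory GRing.Theory Num.Theory.
Import numFieldNormedType.Exports.

Local Open Scope classical_set_scope.
Local Open Scope ring_scope.

(* Unlike [pointwise_cvgP], this does not ask for a topology on [T]. *)
Lemma ptws_cvgP (T : Type) (V : topologicalType)
    (F : set_system {ptws T -> V}) (f : {ptws T -> V}) :
  Filter F -> F --> f <-> forall t, (fun g : {ptws T -> V} => g t) @ F --> f t.
Proof.
move=> FF; rewrite cvg_sup; split => [cvgF t|cvgF t].
(* Each factor topology is induced by evaluation at [t]; [cvg_image] transfers convergence along a
   surjection, and constant functions show that evaluation is onto. *)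
- have : range (fun g : {ptws T -> V} => g t) = setT.
    by rewrite eqEsubset; split=> // v _; exists (fun=> v).
  move=> /cvg_image-/(_ F f FF)/iffLR/(_ (cvgF t)).
  apply: cvg_trans => W /=; rewrite ?nbhs_simpl /fmap /= => [[W' + <-]].
  by apply: filterS => g W'g /=; exists g.
- rewrite cvg_image; last first.
    by rewrite eqEsubset; split=> // v _; exists (fun=> v).
  move=> W /cvgF FW; exists ((fun g : {ptws T -> V} => g t) @^-1` W) => //.
  rewrite eqEsubset; split => [v [g ? <-//]|v Wv].
  by exists (fun=> v).
Qed.

Lemma coord_continuous (T : Type) (V : topologicalType) (t : T) :
  continuous (fun g : {ptws T -> V} => g t).
Proof. by move=> f; apply: (iffLR (ptws_cvgP _ _ (nbhs f) f _)). Qed.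

(** Clipping raises a nonnegative number by an amount in [[0, c]], and two such amounts differ by at
    most [c]. *)
Lemma ler_dist_maxr (R : realDomainType) (c x y : R) :
  0 <= c -> 0 <= x -> 0 <= y -> `|x - y| <= `|Num.max x c - Num.max y c| + c.
Proof.
move=> c0 x0 y0; rewrite ler_norml.
have := ler_norm (Num.max x c - Num.max y c).
have := ler_norm (Num.max y c - Num.max x c); rewrite distrC.
case: (lerP x c) => xc; case: (lerP y c) => yc ? ?; apply/andP; split; lra.
Qed.

Section clipped_log.
Variables (R : realType) (T : Type).

Definition clipped_log (s : {ptws T -> R}) : {ptws (T * R)%type -> R} :=
  fun i => ln (Num.max (s i.1) (expR i.2)).

Lemma expR_clipped_log s i :
  expR (clipped_log s i) = Num.max (s i.1) (expR i.2).
Proof. by rewrite lnK// posrE lt_max expR_gt0 orbT. Qed.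

Lemma ln_maxr_continuous (c : R) :
  0 < c -> continuous (fun x : R => ln (Num.max x c)).
Proof.
move=> c0 x.
have cts_max : {for x, continuous ((id : R -> R^o) \max cst c)}.
  by apply: continuous_max; [exact: cvg_id|exact: cvg_cst].
apply: (continuous_cvg _ _ cts_max).
by apply: continuous_ln; rewrite /= lt_max c0 orbT.
Qed.

Lemma clipped_log_continuous : continuous clipped_log.
Proof.
move=> s; have FF := fmap_filter clipped_log (nbhs_filter s).
(* Left to infer the arguments, unification diverges. *)
apply: (iffRL (@ptws_cvgP (T * R)%type R (clipped_log @ s) _ FF)) => i.
have ln_cts := ln_maxr_continuous _ (expR_gt0 i.2) (s i.1).
exact: (continuous_cvg _ ln_cts (coord_continuous T R i.1 s)).
Qed.

(** A single coordinate of the image determines [s t] up to [expR r]; this yields both injectivity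
    and continuity of the inverse. *)
Lemma ler_dist_clipped_log (s k : {ptws T -> R}) t r :
  0 <= s t -> 0 <= k t ->
  `|s t - k t| <=
    `|expR (clipped_log s (t, r)) - expR (clipped_log k (t, r))| + expR r.
Proof. by rewrite !expR_clipped_log; apply: ler_dist_maxr; exact: expR_ge0. Qed.

Lemma clipped_log_inj : {in @cube R T &, injective clipped_log}.
Proof.
move=> s k /set_mem Cs /set_mem Ck sk; apply/funext => t.
apply/eqP; rewrite -subr_eq0 -normr_le0; apply/ler_addgt0Pl => e e0.
have [/andP[s0 _] /andP[k0 _]] := (Cs t, Ck t).
have := ler_dist_clipped_log s k t (ln e) s0 k0.
by rewrite sk subrr normr0 add0r lnK// addr0.
Qed.

Lemma clipped_log_embedding (S : set {ptws T -> R}) :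
  S `<=` @cube R T -> embedding_on S clipped_log.
Proof.
move=> SC; split; first exact/continuous_subspaceT/clipped_log_continuous.
have inj : {in S &, injective clipped_log}.
  by move=> s k /set_mem/SC/mem_set ? /set_mem/SC/mem_set; exact: clipped_log_inj.
pose g := 'pinv_(fun=> cst 0) S clipped_log.
have gK s : S s -> g (clipped_log s) = s by move=> Ss; apply: pinvKV (mem_set Ss).
exists g; split=> //; apply/subspace_continuousP => _ [s Ss <-].
apply/ptws_cvgP => t; apply/cvgrPdist_lt => e e0.
have FF := nbhs_filter (clipped_log s).
(* Half of [e] pays for the clipping error at [r = ln (e / 2)], the other half for the variation of
   the one image coordinate [(t, r)]. *)
have e20 : 0 < e / 2 by rewrite divr_gt0.
have /cvgrPdist_lt/(_ _ e20) near_s : expR (y (t, ln (e / 2)))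
    @[y --> nbhs (clipped_log s)] --> expR (clipped_log s (t, ln (e / 2))).
  apply: (@continuous_comp _ _ _ (fun y : {ptws (T * R)%type -> R} => y _)).
    exact: coord_continuous.
  exact: continuous_expR.
suff : \forall y \near clipped_log s,
  (clipped_log @` S) y -> `|g (clipped_log s) t - g y t| < e by [].
apply: filterS near_s => _ /[swap] -[k Sk <-] sk.
rewrite !gK//.
have [/andP[s0 _] /andP[k0 _]] := (SC _ Ss t, SC _ Sk t).
apply: le_lt_trans (ler_dist_clipped_log s k t (ln (e / 2)) s0 k0) _.
by rewrite [ltRHS]splitr lnK ?posrE// ltrD2r.
Qed.

Lemma clipped_log_affine (S : set {ptws T -> R}) :
  S `<=` @cube R T -> dot_plus_affine S clipped_log.
Proof.
move=> SC l s k /andP[l0 l1] _ /SC Ck; apply/funext => -[t r].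
have /andP[k0 _] := Ck t.
rewrite /maxplus /= /clipped_log /maxdot /=.
have c0 := expR_gt0 r; set c := expR r in c0 *.
have max_gt0 x : 0 < Num.max x c by rewrite lt_max c0 orbT.
(* The split comes from [lne], which is -oo at 0. There the left side reduces to [k] because [k t]
   is nonnegative. *)
case: ifPn => [l_le0|].
  have -> : l = 0 by apply/eqP; rewrite eq_le l_le0 l0.
  by rewrite mul0r (max_r k0) addNye maxNye.
rewrite -ltNge => l_gt0; rewrite -EFinD -EFin_max -lnM ?posrE//; congr EFin.
have lc : l * c <= c by rewrite ler_piMl// ltW.
have -> : Num.max (Num.max (l * s t) (k t)) c =
    Num.max (l * Num.max (s t) c) (Num.max (k t) c).
  by rewrite maxr_pMr// maxACA (max_r lc).
have a0 := mulr_gt0 l_gt0 (max_gt0 (s t)); have b0 := max_gt0 (k t).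
(* Both arguments are positive, so [ln], being increasing there, commutes with their maximum. *)
have [leAB|/ltW leBA] := leP (l * Num.max (s t) c) (Num.max (k t) c).
  by rewrite [RHS]max_r ?ler_ln ?posrE.
by rewrite [RHS]max_l ?ler_ln ?posrE.
Qed.

End clipped_log.

Theorem theorem1 (R : realType) (T : Type) (S : set {ptws T -> R}) :
  maxdot_convex_compactum S ->
  exists (I : Type) (h : {ptws T -> R} -> {ptws I -> R}),
    embedding_on S h /\ dot_plus_affine S h.
Proof.
move=> [SC _ _]; exists (T * R)%type, (@clipped_log R T).
by split; [exact: clipped_log_embedding|exact: clipped_log_affine].
Qed.
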